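(* Let $\mathcal{A} = I\otimes A_0+\sum_{m=1}^{M}G_m\otimes A_m\in\mathbb{R}^{QN_u\times QN_u}$ be the stochastic Galerkin finite element (SGFE) Laplacian and let $\widetilde{\mathcal{A}}_{\mathrm{mg}} = I\otimes\widetilde{A}_{\mathrm{mg}}$ be its preconditioner, with all matrices and constants as defined in the context. Then $$\hat\delta\;\le\;\frac{\boldsymbol v^{\mathrm T}\mathcal{A}\,\boldsymbol v}{\boldsymbol v^{\mathrm T}\widetilde{\mathcal{A}}_{\mathrm{mg}}\,\boldsymbol v}\;\le\;\hat\Delta\qquad\text{for all }\boldsymbol v\in\mathbb{R}^{QN_u}\setminus\{\boldsymbol 0\},$$ where $\hat\delta:=(\underline{\nu}_0-\sqrt3\,\sigma_\nu\,\chi)\,\delta$ and $\hat\Delta:=(\overline{\nu}_0+\sqrt3\,\sigma_\nu\,\chi)\,\Delta$.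
   Context: Setting. $D\subset\mathbb{R}^2$ is a bounded domain with sufficiently regular boundary, equipped with a regular triangulation of mesh size $h$. Viscosity data. $\nu_0\in L^\infty(D)$ with $\underline{\nu}_0:=\operatorname{ess\,inf}_{D}\nu_0>0$ and $\overline{\nu}_0:=\operatorname{ess\,sup}_{D}\nu_0<\infty$; $\sigma_\nu>0$ is a real number; for $m\in\mathbb{N}$, $\lambda_m\ge 0$ and $\nu_m$ are such that $\sqrt{\lambda_m}\,\nu_m\in L^\infty(D)$. Put $\chi_m:=\|\sqrt{\lambda_m}\,\nu_m\|_{L^\infty(D)}$ and assume $\chi:=\sum_{m=1}^\infty\chi_m<\infty$. Standing assumption: $\underline{\nu}_0>\sqrt3\,\sigma_\nu\,\chi$. (These are the data of a Karhunen-Loève expansion $\nu=\nu_0+\sigma_\nu\sum_{m\ge1}\sqrt{\lambda_m}\,\nu_m y_m$ with independent random variables $y_m$ uniformly distributed on $[-\sqrt3,\sqrt3]$, truncated after $M$ terms.) Finite element matrices. Let $\{\phi_i\}_{i=1}^{N_u}$ be the basis of the space of vector-valued continuous piecewise quadratic functions on the triangulation vanishing on $\partial D$. Define the $N_u\times N_u$ matrices $(A)_{ij}=\int_D\nabla\phi_i\cdot\nabla\phi_j\,dx$, $(A_0)_{ij}=\int_D\nu_0\,\nabla\phi_i\cdot\nabla\phi_j\,dx$ and $(A_m)_{ij}=\int_D\sigma_\nu\sqrt{\lambda_m}\,\nu_m\,\nabla\phi_i\cdot\nabla\phi_j\,dx$ for $m=1,\dots,M$. Multigrid preconditioner. $\widetilde{A}_{\mathrm{mg}}\in\mathbb{R}^{N_u\times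 N_u}$ (one multigrid V-cycle) is symmetric and spectrally equivalent to $A$: there are constants $\delta,\Delta>0$, independent of $h$, with $\delta\le \frac{\boldsymbol v^{\mathrm T}A\boldsymbol v}{\boldsymbol v^{\mathrm T}\widetilde{A}_{\mathrm{mg}}\boldsymbol v}\le\Delta$ for all $\boldsymbol v\in\mathbb{R}^{N_u}\setminus\{\boldsymbol0\}$; in particular $\widetilde A_{\mathrm{mg}}$ is positive definite. Stochastic Galerkin matrices. Let $\rho$ be the uniform probability measure on $[-\sqrt3,\sqrt3]^M$ and let $\{\psi_i\}_{i=1}^{Q}$, $Q=\binom{M+k}{k}$, be the $\rho$-orthonormal Legendre basis of the space of $M$-variate polynomials of total degree at most $k$. Then $I$ is the $Q\times Q$ identity and $(G_m)_{ij}=\int y_m\,\psi_i(y)\psi_j(y)\,\rho(dy)$ for $m=1,\dots,M$. $\otimes$ denotes the Kronecker product. *)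

(* Defs.v *)
From HB Require Import structures.
From mathcomp Require Import all_boot all_order all_algebra.
From mathcomp Require Import all_classical all_reals all_analysis.
From mathcomp Require Import ess_sup_inf mxtens lra.

Set Implicit Arguments.
Unset Strict Implicit.
Unset Printing Implicit Defensive.

Import Order.TTheory GRing.Theory Num.Theory.
Import numFieldNormedType.Exports.

Local Open Scope classical_set_scope.
Local Open Scope ring_scope.

Section Plane.
Variable R : realType.

Definition lebesgue2 :
    {measure set (measurableTypeR R * measurableTypeR R)%type -> \bar R} :=
  @product_measure1 _ _ (measurableTypeR R) (measurableTypeR R) R
    (@lebesgue_measure R) (@lebesgue_measure R).

Lemma open_measurable2 (D : set (R * R)) : open D ->
  measurable (D : set (measurableTypeR R * measurableTypeR R)%type).
Proof.
move=> oD.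
pose box (q : (rat * rat) * (rat * rat)) :
    set (measurableTypeR R * measurableTypeR R)%type :=
  `](ratr q.1.1 : R), ratr q.1.2[ `*` `](ratr q.2.1 : R), ratr q.2.2[.
have -> : D = \bigcup_(q in [set q | box q `<=` D]) box q.
  apply/seteqP; split=> [[x y] Dxy|z [q /= qD /qD]//].
  have := open_nbhs_nbhs (conj oD Dxy).
  rewrite -nbhs_ballE => -[e /= e0 beD].
  have [a1 xa1] : exists q : rat, ratr q \in `](x - e), x[%R.
    by apply: rat_in_itvoo; lra.
  have [a2 xa2] : exists q : rat, ratr q \in `]x, (x + e)[%R.
    by apply: rat_in_itvoo; lra.
  have [b1 yb1] : exists q : rat, ratr q \in `](y - e), y[%R.
    by apply: rat_in_itvoo; lra.
  have [b2 yb2] : exists q : rat, ratr q \in `]y, (y + e)[%R.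
    by apply: rat_in_itvoo; lra.
  move: xa1 xa2 yb1 yb2; rewrite !in_itv/= => /andP[? ?] /andP[? ?] /andP[? ?]
    /andP[? ?].
  exists ((a1, a2), (b1, b2)); last by split; rewrite /= in_itv/=; apply/andP.
  move=> [u v] [] /=; rewrite !in_itv/= => /andP[? ?] /andP[? ?].
  by apply: beD; split; rewrite /ball/= ltr_distlC; apply/andP; split; lra.
rewrite bigcup_mkcond; apply: countable_bigcupT_measurable => // q.
case: ifPn => // _; exact: measurableX.
Qed.

Record domain := Domain {
  dom_set :> set (R * R);
  dom_open : open dom_set;
  dom_connected : connected dom_set;
  dom_bounded : bounded_set dom_set;
  dom_nonempty : dom_set !=set0 }.

Definition lebesgue_on (D : domain) :
    {measure set (measurableTypeR R * measurableTypeR R)%type -> \bar R} :=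
  mrestr lebesgue2 (open_measurable2 (@dom_open D)).

(* As [D] is open, [closure D `\` D] is its boundary. *)
Definition boundary (D : domain) : set (R * R) := closure D `\` D.

Definition vertices := 'I_3 -> R * R.

Definition affinely_independent (P : vertices) : Prop :=
  forall w : 'I_3 -> R,
    \sum_i w i = 0 -> \sum_i w i *: P i = 0 -> forall i, w i = 0.

(* The face spanned by the vertices with index in [s]: the whole closed triangle
   for [s = setT], an edge, a vertex, or the empty set for [s = set0]. *)
Definition face (P : vertices) (s : {set 'I_3}) : set (R * R) :=
  [set x | exists w : 'I_3 -> R,
    [/\ forall i, 0 <= w i, \sum_i w i = 1, forall i, i \notin s -> w i = 0
      & x = \sum_i w i *: P i]].

Definition triangle (P : vertices) : set (R * R) := face P [set: 'I_3]%SET.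

(* The last field is conformity: two distinct triangles meet in a common proper
   face, possibly empty. *)
Record triangulation (D : domain) := Triangulation {
  tri_num : nat;
  tri : 'I_tri_num -> vertices;
  tri_nondegenerate : forall t, affinely_independent (tri t);
  tri_cover : closure D = \bigcup_(t in [set: 'I_tri_num]) triangle (tri t);
  tri_conforming : forall t t', t != t' ->
    exists s s' : {set 'I_3},
      [/\ s != [set: 'I_3]%SET, s' != [set: 'I_3]%SET,
          triangle (tri t) `&` triangle (tri t') = face (tri t) s
        & triangle (tri t) `&` triangle (tri t') = face (tri t') s'] }.

Definition quadratic_on (K : set (R * R)) (u : R * R -> R) : Prop :=
  exists a b c d e f : R, forall x, K x ->
    u x = a + b * x.1 + c * x.2 + d * x.1 ^+ 2 + e * (x.1 * x.2) + f * x.2 ^+ 2.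

(* A member is only looked at on [closure D]; its values elsewhere are junk. *)
Definition P2_space (D : domain) (Th : triangulation D) :
    set (R * R -> 'rV[R]_2) :=
  [set f : R * R -> 'rV[R]_2 | [/\ {within closure D, continuous f},
      forall t a, quadratic_on (triangle (@tri D Th t)) (fun x => f x 0 a)
    & forall x, boundary D x -> f x = 0]].

Definition P2_basis (D : domain) (Th : triangulation D) (N : nat)
    (phi : 'I_N -> R * R -> 'rV[R]_2) : Prop :=
  (forall i, P2_space Th (phi i)) /\
  (forall f, P2_space Th f -> exists! c : 'rV[R]_N,
     forall x, closure D x -> f x = \sum_i c 0 i *: phi i x).

(* The Frobenius product of the Jacobians of [f] and [g]. For members of
   [P2_space] the classical derivatives exist inside every triangle; the library's
   default value on the edges, a null set, does not affect integrals. *)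
Definition grad_dot (f g : R * R -> 'rV[R]_2) (x : R * R) : R :=
  \sum_(a < 2)
    ('D_(1, 0) (fun z => f z 0 a) x * 'D_(1, 0) (fun z => g z 0 a) x +
     'D_(0, 1) (fun z => f z 0 a) x * 'D_(0, 1) (fun z => g z 0 a) x).

Definition stiffness (D : domain) (N : nat) (phi : 'I_N -> R * R -> 'rV[R]_2)
    (a : R * R -> R) : 'M[R]_N :=
  \matrix_(i, j) \int[lebesgue2]_(x in D) (a x * grad_dot (phi i) (phi j) x).

Definition KL_term (sigma : R) (lambda : nat -> R) (nu : nat -> R * R -> R)
    (m : nat) (x : R * R) : R :=
  sigma * Num.sqrt (lambda m) * nu m x.

(* Indices start at 1, here and in [chi]; [lambda 0] and [nu 0] are not used. *)
Definition chi_term (D : domain) (lambda : nat -> R) (nu : nat -> R * R -> R)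
    (m : nat) : \bar R :=
  'N[lebesgue_on D]_+oo[EFin \o (fun x => Num.sqrt (lambda m) * nu m x)].

Definition chi (D : domain) (lambda : nat -> R) (nu : nat -> R * R -> R) : \bar R :=
  (\sum_(1 <= m <oo) chi_term D lambda nu m)%E.

End Plane.

Section Stochastic.
Variable R : realType.

Lemma ltNsqrt3 : - Num.sqrt 3 < Num.sqrt 3 :> R.
Proof. by rewrite gtrN// sqrtr_gt0. Qed.

Definition cons_tuple (n : nat)
    (p : (measurableTypeR R * n.-tuple (measurableTypeR R))%type) :
    n.+1.-tuple (measurableTypeR R) := [tuple of p.1 :: p.2].

Lemma measurable_cons_tuple n : measurable_fun setT (@cons_tuple n).
Proof. exact: (measurable_cons measurable_fst measurable_snd). Qed.

HB.instance Definition _ n := isMeasurableFun.Build _ _ _ _ (@cons_tuple n)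
  (@measurable_cons_tuple n).

(* The [n]-fold product of the uniform probability on [-sqrt 3, sqrt 3]. *)
Fixpoint uniform_cube (n : nat) : probability (n.-tuple (measurableTypeR R)) R :=
  match n with
  | 0 => \d_ [tuple]
  | n.+1 => distribution (uniform_prob ltNsqrt3 \x uniform_cube n)%E (@cons_tuple n)
  end.

(* Bonnet's recurrence; normalised by [(legendre n).[1] = 1]. *)
Fixpoint legendre (n : nat) : {poly R} :=
  match n with
  | 0 => 1
  | n1.+1 => match n1 with
    | 0 => 'X
    | n2.+1 => (n1.+1)%:R^-1 *:
        (n1.*2.+1%:R *: ('X * legendre n1) - n1%:R *: legendre n2)
    end
  end.

(* Up to a positive factor, [psi i] is the tensor product of the Legendre
   polynomials (transported to [-sqrt 3, sqrt 3]) whose degrees are given by the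
   multi-index [alpha i]; [alpha] enumerates without repetition the multi-indices
   of total degree at most [k]. Orthonormality fixes the factors. *)
Definition legendre_basis (M k Q : nat) (psi : 'I_Q -> M.-tuple R -> R) : Prop :=
  (exists alpha : 'I_Q -> {ffun 'I_M -> nat},
    [/\ injective alpha,
        forall b : {ffun 'I_M -> nat}, (\sum_m b m <= k)%N <-> exists i, alpha i = b
      & forall i, exists2 c : R, 0 < c & forall y,
          psi i y = c * \prod_m (legendre (alpha i m)).[tnth y m / Num.sqrt 3]]) /\
  (forall i j, \int[uniform_cube M]_y (psi i y * psi j y) = (i == j)%:R).

Definition galerkin (M Q : nat) (psi : 'I_Q -> M.-tuple R -> R) (m : 'I_M) :
    'M[R]_Q :=
  \matrix_(i, j) \int[uniform_cube M]_y (tnth y m * psi i y * psi j y).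

(* [*t] is the Kronecker product. The ordinal [m : 'I_M] counts from 0 and stands
   for the index [m.+1] of the expansion. *)
Definition sgfe_laplacian (D : domain R) (N : nat)
    (phi : 'I_N -> R * R -> 'rV[R]_2) (nu0 : R * R -> R) (sigma : R)
    (lambda : nat -> R) (nu : nat -> R * R -> R) (M Q : nat)
    (psi : 'I_Q -> M.-tuple R -> R) : 'M[R]_(Q * N) :=
  1%:M *t stiffness D phi nu0 +
  \sum_(m < M)
    galerkin psi m *t stiffness D phi (KL_term sigma lambda nu m.+1).

Definition rayleigh (n : nat) (A B : 'M[R]_n) (v : 'cV[R]_n) : R :=
  (v^T *m A *m v) 0 0 / (v^T *m B *m v) 0 0.

End Stochastic.

(* Main.v *)
Require Import Defs.
From mathcomp Require Import all_boot all_order all_algebra.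
From mathcomp Require Import all_classical all_reals all_analysis.
From mathcomp Require Import ess_sup_inf measurable_realfun mxtens ring lra.

Set Implicit Arguments.
Unset Strict Implicit.
Unset Printing Implicit Defensive.

Import Order.TTheory GRing.Theory Num.Theory.
Import numFieldNormedType.Exports.

Local Open Scope classical_set_scope.
Local Open Scope ring_scope.

(* Written as an integral over D, the quadratic form of the SGFE Laplacian has
   the integrand nu_0 S + sum_m nu_m F_m, where S = sum_i |grad u_i|^2 for the
   block functions u_i of v, and F_m applies the Galerkin matrix G_m to each
   component of the gradients. As |y_m| <= sqrt 3 almost surely and the psi_i are
   orthonormal, |c^T G_m c| <= sqrt 3 |c|^2, so |F_m| <= sqrt 3 S pointwise.
   Hence the integrand lies between (inf nu_0 - sqrt 3 sigma chi) S and
   (sup nu_0 + sqrt 3 sigma chi) S, and the integral of S is the sum over the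
   blocks of v of the quadratic form of A, which the preconditioner controls
   blockwise.

   All integrals are moved to a set of full measure on which the gradients of
   the finite element functions are bounded and measurable and the a.e. bounds
   on the coefficients hold everywhere. *)

(** * Integrals of arbitrary functions and null sets *)

Section NullSets.
Context d (T : measurableType d) (R : realType).
Variable mu : {measure set T -> \bar R}.

Import HBNNSimple.

(** The integral is a supremum over simple functions below the integrand, extended by zero. Those
    admissible for [E] are admissible for [D]; conversely, multiplying by the indicator of the
    complement of the null set makes a function admissible for [E] without changing its integral. *)
Lemma ge0_integral_null_setD (D E : set T) (f : T -> \bar R) :
  E `<=` D -> measurable (D `\` E) -> mu (D `\` E) = 0%E ->
  (forall x, D x -> 0 <= f x)%E ->
  (\int[mu]_(x in D) f x = \int[mu]_(x in E) f x)%E.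
Proof.
move=> ED mN N0 f0.
rewrite ge0_integralE// ge0_integralE; last by move=> x /ED/f0.
apply/eqP; rewrite eq_le; apply/andP; split; last first.
  apply: ge_ereal_sup => _ [h /= hf <-]; apply: ereal_sup_ubound.
  exists h => //= x; apply: (le_trans (hf x)); rewrite /patch.
  case: ifPn => [/set_mem/ED /mem_set ->//|_].
  by case: ifPn => // /set_mem/f0.
apply: ge_ereal_sup => _ [h /= hf <-]; apply: ereal_sup_ubound.
have mC : measurable (~` (D `\` E)) by exact: measurableC.
exists (mul_nnsfun h (indic_nnsfun R mC)) => [x /=|].
  have -> : indic_nnsfun R mC x = (x \in ~` (D `\` E))%:R by [].
  case: (boolP (x \in ~` (D `\` E))) => [/set_mem nDE|_].
    rewrite mulr1; apply: (le_trans (hf x)); rewrite /patch.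
    case: ifPn => [/set_mem Dx|_].
      rewrite ifT//; apply: mem_set; apply: contrapT => Ex.
      exact: (nDE (conj Dx Ex)).
    by case: ifPn => // /set_mem/ED/f0.
  by rewrite mulr0 /patch; case: ifPn => // /set_mem/ED/f0.
rewrite -!integralT_nnsfun; apply: ae_eq_integral => //.
- by apply/measurable_EFinP; exact: measurable_funTS.
- by apply/measurable_EFinP; exact: measurable_funTS.
exists (D `\` E); split => // x /= /not_implyP[_ hx].
apply: contrapT => nDE; apply: hx.
congr EFin; transitivity (h x * (x \in ~` (D `\` E))%:R) => //.
by rewrite mem_set ?mulr1.
Qed.

(* [f] is not assumed measurable: the integral is a supremum over simple
   functions, and these may be cut off on the null set [D `\` E]. *)
Lemma integral_null_setD (D E : set T) (f : T -> \bar R) :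
  E `<=` D -> measurable (D `\` E) -> mu (D `\` E) = 0%E ->
  (\int[mu]_(x in D) f x = \int[mu]_(x in E) f x)%E.
Proof.
by move=> ED mN N0; rewrite integralE [RHS]integralE; congr (_ - _)%E;
  apply: ge0_integral_null_setD.
Qed.

End NullSets.

(** * Bounded measurable functions *)

Section BoundedMeasurable.
Context d (T : measurableType d) (R : realType).
Implicit Types (E : set T) (f g : T -> R).

(** This class is closed under sums, products and composition with polynomials, and its members are
    integrable over sets of finite measure; linearity of the integral then needs no separate
    integrability arguments. *)
Definition bounded_mfun E f :=
  measurable_fun E f /\ exists C, forall x, E x -> `|f x| <= C.

Lemma bounded_mfun_cst E c : bounded_mfun E (cst c).
Proof. by split; [exact: measurable_cst|exists `|c|]. Qed.

Lemma bounded_mfunD E f g : bounded_mfun E f -> bounded_mfun E g ->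
  bounded_mfun E (fun x => f x + g x).
Proof.
move=> [mf [B fB]] [mg [C gC]]; split; first exact: measurable_funD.
exists (B + C) => x Ex; rewrite (le_trans (ler_normD _ _))// lerD//; auto.
Qed.

Lemma bounded_mfunM E f g : bounded_mfun E f -> bounded_mfun E g ->
  bounded_mfun E (fun x => f x * g x).
Proof.
move=> [mf [B fB]] [mg [C gC]]; split; first exact: measurable_funM.
by exists (B * C) => x Ex; rewrite normrM ler_pM//; auto.
Qed.

Lemma bounded_mfun_sum E I (s : seq I) (f : I -> T -> R) :
  (forall i, bounded_mfun E (f i)) ->
  bounded_mfun E (fun x => \sum_(i <- s) f i x).
Proof.
move=> bf; elim: s => [|i s IH].
  by under eq_fun do rewrite big_nil; exact: bounded_mfun_cst.
by under eq_fun do rewrite big_cons; exact: bounded_mfunD.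
Qed.

Lemma bounded_mfun_prod E I (s : seq I) (f : I -> T -> R) :
  (forall i, bounded_mfun E (f i)) ->
  bounded_mfun E (fun x => \prod_(i <- s) f i x).
Proof.
move=> bf; elim: s => [|i s IH].
  by under eq_fun do rewrite big_nil; exact: bounded_mfun_cst.
by under eq_fun do rewrite big_cons; exact: bounded_mfunM.
Qed.

Lemma bounded_mfun_horner E (p : {poly R}) f :
  bounded_mfun E f -> bounded_mfun E (fun x => p.[f x]).
Proof.
move=> bf; elim/poly_ind: p => [|p c IH].
  by under eq_fun do rewrite horner0; exact: bounded_mfun_cst.
under eq_fun do rewrite hornerMXaddC.
by apply: bounded_mfunD; [exact: bounded_mfunM|exact: bounded_mfun_cst].
Qed.

Lemma eq_bounded_mfun E f g : {in E, f =1 g} -> bounded_mfun E f ->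
  bounded_mfun E g.
Proof.
move=> fg [mf [C fC]]; split; first exact: eq_measurable_fun mf.
by exists C => x Ex; rewrite -fg ?inE//; exact: fC.
Qed.

Lemma bounded_mfunS E (F : set T) f : measurable E -> F `<=` E ->
  bounded_mfun E f -> bounded_mfun F f.
Proof.
move=> mE FE [mf [C fC]]; split; first exact: measurable_funS mf.
by exists C => x /FE; exact: fC.
Qed.

Lemma bounded_mfun_bigcup (I : finType) (F : I -> set T) f :
  (forall i, measurable (F i)) -> (forall i, bounded_mfun (F i) f) ->
  bounded_mfun (\bigcup_(i in [set: I]) F i) f.
Proof.
move=> mF bf; split => [_ Y mY|].
  rewrite setI_bigcupl; apply: fin_bigcup_measurable => // i _.
  by have [+ _] := bf i; exact.
have /choice[C fC] i : exists C, forall x, F i x -> `|f x| <= C.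
  by have [] := bf i.
(* Absolute values are taken because [C i] may be negative when [F i] is empty. *)
exists (\sum_i `|C i|) => x [i _ Fix].
rewrite (bigD1 i)//= ler_wpDr ?sumr_ge0//.
by rewrite (le_trans (fC _ _ Fix))// ler_norm.
Qed.

Variable mu : {measure set T -> \bar R}.

Lemma bounded_mfun_integrable E f : measurable E -> (mu E < +oo)%E ->
  bounded_mfun E f -> mu.-integrable E (EFin \o f).
Proof.
move=> mE Eoo [mf [C fC]]; apply: measurable_bounded_integrable => //.
exists C; split; first exact: num_real.
by move=> r Cr x /fC fxC; exact: le_trans fxC (ltW Cr).
Qed.

Lemma Rintegral_sum E I (s : seq I) (f : I -> T -> R) :
  measurable E -> (mu E < +oo)%E -> (forall i, bounded_mfun E (f i)) ->
  \int[mu]_(x in E) (\sum_(i <- s) f i x) =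
  \sum_(i <- s) \int[mu]_(x in E) f i x.
Proof.
move=> mE Eoo bf; elim: s => [|i s IH].
  rewrite big_nil; under eq_Rintegral do rewrite big_nil.
  by rewrite Rintegral_cst// mul0r.
rewrite big_cons -IH -RintegralD//; last 2 first.
- exact: bounded_mfun_integrable.
- by apply: bounded_mfun_integrable => //; exact: bounded_mfun_sum.
by under eq_Rintegral do rewrite big_cons.
Qed.

(** Turns a bilinear form into one integral, both for the Galerkin matrices, with weight [y_m], and
    for the stiffness matrices, with the coefficient as weight. *)
Lemma Rintegral_form E n (g : T -> R) (p : 'I_n -> T -> R) (b c : 'I_n -> R) :
  measurable E -> (mu E < +oo)%E -> bounded_mfun E g ->
  (forall i, bounded_mfun E (p i)) ->
  \int[mu]_(x in E)
    (g x * ((\sum_i b i * p i x) * (\sum_j c j * p j x))) =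
  \sum_i \sum_j b i * c j * \int[mu]_(x in E) (g x * (p i x * p j x)).
Proof.
move=> mE Eoo bg bp.
have bgpp i j : bounded_mfun E (fun x => g x * (p i x * p j x)).
  by apply: bounded_mfunM => //; exact: bounded_mfunM.
have bcgpp i j : bounded_mfun E (fun x => b i * c j * (g x * (p i x * p j x))).
  by apply: bounded_mfunM => //; exact: bounded_mfun_cst.
transitivity (\int[mu]_(x in E)
    \sum_i \sum_j b i * c j * (g x * (p i x * p j x))).
  apply: eq_Rintegral => x _; rewrite mulr_suml mulr_sumr; apply: eq_bigr => i _.
  by rewrite mulr_sumr mulr_sumr; apply: eq_bigr => j _; ring.
rewrite Rintegral_sum//; last by move=> i; exact: bounded_mfun_sum.
apply: eq_bigr => i _; rewrite Rintegral_sum//; apply: eq_bigr => j _.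
by rewrite RintegralZl//; exact: bounded_mfun_integrable.
Qed.

End BoundedMeasurable.

(** * The uniform measure on the cube and the Galerkin matrices *)

Section UniformCube.
Variable R : realType.

(** The measure [uniform_cube] lives on all tuples, where polynomials are unbounded; this set
    carries its whole mass. *)
Definition cube n : set (n.-tuple (measurableTypeR R)) :=
  [set y | forall i, `|tnth y i| <= Num.sqrt 3].

Lemma measurable_tnth_gt n (i : 'I_n) (r : R) :
  measurable [set y : n.-tuple (measurableTypeR R) | r < `|tnth y i|].
Proof.
have := @measurable_tnth _ (measurableTypeR R) n i measurableT
  [set z : R | r < `|z| ].
rewrite setTI; apply.
have := @normr_measurable R setT measurableT `]r, +oo[%classic.
rewrite setTI => /(_ (measurable_itv _)); congr (measurable _).
by apply/seteqP; split=> z /=; rewrite in_itv/= andbT.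
Qed.

(** By induction: the measure is the image of a product under [cons_tuple], and the preimage of the
    event is a rectangle with a null factor. For a later coordinate this is the induction
    hypothesis; for the first one, the event misses the interval that supports the density. *)
Lemma uniform_cube_tnth_gt n (i : 'I_n) :
  uniform_cube R n [set y | Num.sqrt 3 < `|tnth y i|] = 0%E.
Proof.
elim: n i => [[]//|n IH] i.
rewrite /= /distribution /pushforward.
case: (unliftP ord0 i) => [j ->|->].
  transitivity ((uniform_prob (ltNsqrt3 R) \x uniform_cube R n)%E
    (setT `*` [set y | Num.sqrt 3 < `|tnth y j|])).
    congr (product_measure1 _ _ _).
    by apply/seteqP; split=> -[a y] /=; rewrite tnthS //=; case.
  rewrite product_measure1E; [|exact: measurableT|exact: measurable_tnth_gt].
  rewrite -[RHS](mule0 (uniform_prob (ltNsqrt3 R) setT)); congr (_ * _)%E.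
  exact: IH.
have mA : measurable [set z : measurableTypeR R | Num.sqrt 3 < `|z| ].
  have := @normr_measurable R setT measurableT `]Num.sqrt 3, +oo[%classic.
  rewrite setTI => /(_ (measurable_itv _)); congr (measurable _).
  by apply/seteqP; split=> z /=; rewrite in_itv/= andbT.
transitivity ((uniform_prob (ltNsqrt3 R) \x uniform_cube R n)%E
    ([set z | Num.sqrt 3 < `|z| ] `*` setT)).
  congr (product_measure1 _ _ _).
  by apply/seteqP; split=> -[a y] /=; rewrite ?tnth0 //; case.
rewrite product_measure1E//.
rewrite -[RHS](mul0e (uniform_cube R n setT)); congr (_ * _)%E.
suff : uniform_prob (ltNsqrt3 R) [set z | Num.sqrt 3 < `|z| ] = 0%E by [].
rewrite /uniform_prob integral_uniform_pdf.
rewrite (_ : _ `&` _ = set0) ?integral_set0//.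
apply/seteqP; split => // z [] /=; rewrite in_itv/= -ler_norml.
by rewrite leNgt => ->.
Qed.

Lemma measurable_cube n : measurable (@cube n).
Proof.
rewrite (_ : @cube n = ~` \bigcup_(i in [set: 'I_n])
    [set y | Num.sqrt 3 < `|tnth y i|]); last first.
  apply/seteqP; split=> y /=.
    by move=> cy [i _] /=; rewrite ltNge cy.
  by move=> cy i; rewrite leNgt; apply/negP => yi; apply: cy; exists i.
apply: measurableC; apply: fin_bigcup_measurable => // i _.
exact: measurable_tnth_gt.
Qed.

Lemma uniform_cube_setC_cube n : uniform_cube R n (~` @cube n) = 0%E.
Proof.
apply: measure_negligible; first by apply: measurableC; exact: measurable_cube.
suff : \forall y \ae uniform_cube R n, forall i, `|tnth y i| <= Num.sqrt 3 by [].
apply: filter_forall => i; exists [set y | Num.sqrt 3 < `|tnth y i|]; split.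
- exact: measurable_tnth_gt.
- exact: uniform_cube_tnth_gt.
- by move=> y /= /negP; rewrite -ltNge.
Qed.

Lemma bounded_mfun_tnth n (i : 'I_n) :
  bounded_mfun (@cube n) (fun y => tnth y i).
Proof.
split; first by apply: measurable_funTS; exact: measurable_tnth.
by exists (Num.sqrt 3) => y; apply.
Qed.

Lemma bounded_mfun_legendre_basis M k Q (psi : 'I_Q -> M.-tuple R -> R) i :
  legendre_basis k psi -> bounded_mfun (@cube M) (psi i).
Proof.
move=> [[alpha [_ _ /(_ i) [c _ psiE]]] _].
rewrite (_ : psi i = fun y => c * \prod_m
  (legendre R (alpha i m)).[tnth y m / Num.sqrt 3]); last exact/funext.
apply: bounded_mfunM; first exact: bounded_mfun_cst.
apply: bounded_mfun_prod => m; apply: bounded_mfun_horner.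
by apply: bounded_mfunM; [exact: bounded_mfun_tnth|exact: bounded_mfun_cst].
Qed.

Lemma Rintegral_uniform_cube n f :
  \int[uniform_cube R n]_y f y = \int[uniform_cube R n]_(y in @cube n) f y.
Proof.
rewrite /Rintegral (integral_null_setD (E := @cube n)) ?setTD//.
- by apply: measurableC; exact: measurable_cube.
- exact: uniform_cube_setC_cube.
Qed.

(** With [P] the combination of the [psi i] with coefficients [c i], the form is the integral of y_m
    P^2, and by orthonormality the sum of squares is the integral of P^2. On the cube |y_m| <= sqrt
    3. *)
Lemma galerkin_form_le M k Q (psi : 'I_Q -> M.-tuple R -> R) m
    (c : 'I_Q -> R) : legendre_basis k psi ->
  `|\sum_i \sum_j galerkin psi m i j * (c i * c j)|
    <= Num.sqrt 3 * \sum_i c i ^+ 2.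
Proof.
move=> psiL; have [_ psi_orth] := psiL.
have bpsi i := bounded_mfun_legendre_basis i psiL.
have mK := @measurable_cube M.
have Koo : (uniform_cube R M (@cube M) < +oo)%E.
  by rewrite (le_lt_trans (probability_le1 _ mK))// ltry.
pose P y := \sum_i c i * psi i y.
have bP : bounded_mfun (@cube M) P.
  by apply: bounded_mfun_sum => i; apply: bounded_mfunM => //;
    exact: bounded_mfun_cst.
have bP2 : bounded_mfun (@cube M) (fun y => P y * P y).
  exact: bounded_mfunM.
have bT := bounded_mfun_tnth m.
have -> : \sum_i \sum_j galerkin psi m i j * (c i * c j) =
    \int[uniform_cube R M]_(y in @cube M) (tnth y m * (P y * P y)).
  rewrite /P Rintegral_form//; apply: eq_bigr => i _; apply: eq_bigr => j _.
  rewrite mxE Rintegral_uniform_cube mulrC; congr (_ * _).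
  by under eq_Rintegral do rewrite -mulrA.
(* The factor 1 is the constant weight for [Rintegral_form]. *)
have -> : \sum_i c i ^+ 2 =
    \int[uniform_cube R M]_(y in @cube M) (1 * (P y * P y)).
  rewrite /P (Rintegral_form (g := cst 1))//; last exact: bounded_mfun_cst.
  apply: eq_bigr => i _; rewrite (bigD1 i)//= big1 => [|j ji].
    under eq_Rintegral do rewrite mul1r.
    by rewrite -Rintegral_uniform_cube psi_orth eqxx mulr1 addr0 expr2.
  under eq_Rintegral do rewrite mul1r.
  by rewrite -Rintegral_uniform_cube psi_orth eq_sym (negbTE ji) mulr0.
apply: (le_trans (le_normr_Rintegral _ _)) => //.
  by apply: bounded_mfun_integrable => //; exact: bounded_mfunM.
under [X in _ <= _ * X]eq_Rintegral do rewrite mul1r.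
rewrite -RintegralZl//; last exact: bounded_mfun_integrable.
apply: le_Rintegral => //.
- apply: integrable_norm; apply: bounded_mfun_integrable => //.
  exact: bounded_mfunM.
- apply: bounded_mfun_integrable => //; apply: bounded_mfunM => //.
  exact: bounded_mfun_cst.
move=> y Ky; rewrite normrM [X in _ * X]ger0_norm -?expr2 ?sqr_ge0//.
by rewrite ler_wpM2r ?sqr_ge0.
Qed.

End UniformCube.

(** * Triangles, lines and derivatives of piecewise quadratic functions *)

Section Triangulation.
Variable R : realType.
Local Notation plane := (measurableTypeR R * measurableTypeR R)%type.

Lemma lebesgue2X (A B : set (measurableTypeR R)) :
  measurable A -> measurable B ->
  lebesgue2 R (A `*` B) = (@lebesgue_measure R A * @lebesgue_measure R B)%E.
Proof. exact: product_measure1E. Qed.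

(** Serves both for barycentric coordinates and for directional derivatives of quadratics. *)
Definition affine_fun (a b c : R) (x : R * R) : R := a + b * x.1 + c * x.2.

Lemma measurable_affine_fun a b c :
  measurable_fun [set: plane] (affine_fun a b c : plane -> R).
Proof.
apply: measurable_funD; first apply: measurable_funD => //.
- by apply: measurable_funM => //; exact: measurable_fst.
- by apply: measurable_funM => //; exact: measurable_snd.
Qed.

Lemma continuous_affine_fun a b c : continuous (affine_fun a b c).
Proof.
move=> x; apply: cvgD; first (apply: cvgD; first exact: cvg_cst).
- by apply: cvgM; [exact: cvg_cst|exact: cvg_fst].
- by apply: cvgM; [exact: cvg_cst|exact: cvg_snd].
Qed.

(** If [c = 0], the line is a point times the real axis; otherwise each section at a fixed first
    coordinate is a single point. *)
Lemma lebesgue2_line a b c : (b != 0) || (c != 0) ->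
  (lebesgue2 R).-negligible [set x | affine_fun a b c x = 0].
Proof.
move=> bc0.
have mL : measurable ([set x | affine_fun a b c x = 0] : set plane).
  have := measurable_affine_fun a b c measurableT (measurable_set1 (0 : R)).
  by rewrite setTI.
apply/negligibleP => //.
suff : lebesgue2 R [set x | affine_fun a b c x = 0] = 0%E by [].
have [c0|c0] := eqVneq c 0.
  have {bc0}b0 : b != 0 by move: bc0; rewrite c0 eqxx orbF.
  have -> : [set x | affine_fun a b c x = 0] = [set - a / b] `*` setT.
    apply/seteqP; split=> -[x y]; rewrite /affine_fun /= c0 mul0r addr0.
      move=> abx; split => //; apply: (mulfI b0).
      by rewrite mulrCA divff// mulr1; apply/eqP; rewrite -addr_eq0 addrC abx.
    by move=> [-> _]; rewrite mulrCA divff// mulr1 subrr.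
  rewrite lebesgue2X//.
  by rewrite lebesgue_measure_set1 mul0e.
(* The product measure is by definition the integral of the measures of the sections. *)
apply: integral0_eq => x _ /=.
rewrite (_ : xsection _ _ = [set - (a + b * x) / c]).
  exact: lebesgue_measure_set1.
apply/seteqP; split=> y; rewrite /xsection /= inE /affine_fun /=.
  move=> abcy; apply: (mulfI c0); rewrite mulrCA divff// mulr1.
  by apply/eqP; rewrite -addr_eq0 addrC abcy.
by move=> ->; rewrite mulrCA divff// mulr1 subrr.
Qed.

(** The matrix [A] with rows (1, P_i) sends weights to their sum together with the point they
    represent, so affine independence makes it invertible. Column [i] of the inverse holds the
    coefficients of the [i]-th coordinate function. *)
Lemma barycentric_coords (P : vertices R) : affinely_independent P ->
  exists a b c : 'I_3 -> R,
    [/\ forall i, (b i != 0) || (c i != 0),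
        forall w x, \sum_i w i = 1 -> x = \sum_i w i *: P i ->
          forall i, affine_fun (a i) (b i) (c i) x = w i
      & forall x, \sum_i affine_fun (a i) (b i) (c i) x = 1 /\
          x = \sum_i affine_fun (a i) (b i) (c i) x *: P i].
Proof.
move=> indP.
pose h x : 'rV[R]_3 := \row_k [:: 1; x.1; x.2]`_k.
pose A : 'M[R]_3 := \matrix_(i, k) [:: 1; (P i).1; (P i).2]`_k.
have AE (w : 'rV[R]_3) s x : (w *m A = \row_k [:: s; x.1; x.2]`_k) <->
    \sum_i w 0 i = s /\ \sum_i w 0 i *: P i = x.
  have -> : w *m A = \row_k [:: \sum_i w 0 i; (\sum_i w 0 i *: P i).1;
      (\sum_i w 0 i *: P i).2]`_k.
    apply/rowP => k; rewrite !mxE.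
    rewrite (big_morph fst (fun _ _ => erefl) (erefl : (0 : R * R).1 = 0)).
    rewrite (big_morph snd (fun _ _ => erefl) (erefl : (0 : R * R).2 = 0)).
    by case: k => -[|[|[|//]]] ? /=; apply: eq_bigr => i _;
      rewrite mxE /= ?mulr1.
  split=> [/rowP e|[-> ->]//].
  have := e 0; have := e 1; have := e (inord 2).
  rewrite !mxE /= inordK//= => e2 e1 e0; split => //.
  by case: x (\sum_i _) e1 e2 {e} => [x1 x2] [y1 y2] /= -> ->.
have Au : A \in unitmx.
  rewrite -row_free_unit; apply: inj_row_free => v vA0.
  have /AE[v0 vP0] : v *m A = \row_k [:: 0; (0 : R * R).1; (0 : R * R).2]`_k.
    by rewrite vA0; apply/rowP; case=> -[|[|[|//]]] ?; rewrite !mxE.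
  by apply/rowP => i; rewrite mxE; exact: (indP (fun i => v 0 i)).
pose B := invmx A.
pose l i x := affine_fun (B 0 i) (B 1 i) (B (inord 2) i) x.
have lE x : h x *m B = \row_i l i x.
  apply/rowP => i; rewrite !mxE !big_ord_recl big_ord0 !mxE /= mul1r addr0.
  rewrite /l /affine_fun addrA [x.1 * _]mulrC [x.2 * _]mulrC.
  by congr (B _ _ + B _ _ * _ + B _ _ * _); apply: val_inj; rewrite /= ?inordK.
exists (B 0), (B 1), (B (inord 2)); split=> [i|w x w1 xw i|x].
(* A constant coordinate function would have to be 1 at vertex [i] and 0 at the other vertex
   [lift i ord0]. *)
- rewrite -negb_and; apply/negP => /andP[/eqP B1 /eqP B2].
  have lB x : l i x = B 0 i by rewrite /l /affine_fun B1 B2 !mul0r !addr0.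
  have AB j : (A *m B) j i = B 0 i.
    rewrite -(lB (P j)); transitivity ((h (P j) *m B) 0 i).
      by rewrite !mxE; apply: eq_bigr => k _; rewrite !mxE.
    by rewrite lE mxE.
  have := AB i; rewrite mulmxV// mxE eqxx => /esym B0.
  have := AB (lift i ord0); rewrite mulmxV// mxE eq_sym (negbTE (neq_lift _ _)).
  by rewrite B0 => /eqP; rewrite eq_sym oner_eq0.
- have : (\row_i w i) *m A = h x.
    by apply/AE; split; [rewrite -w1|rewrite xw]; apply: eq_bigr => j _;
      rewrite mxE.
  move=> /(congr1 (mulmx^~ B)); rewrite mulmxK// lE => /rowP/(_ i).
  by rewrite !mxE.
- have /AE[+ +] : (\row_i l i x) *m A = h x by rewrite -lE mulmxKV.
  under eq_bigr do rewrite mxE.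
  move=> -> e; split => //; rewrite -[LHS]e.
  by apply: eq_bigr => i _; rewrite mxE.
Qed.

(** For nonzero [h] the difference quotient is exactly L + q h, where [q] is the homogeneous
    quadratic part evaluated at [v]. *)
Lemma derive_quadratic (a b c d e f : R) (x v : R * R) :
  'D_v (fun x : R * R => a + b * x.1 + c * x.2 + d * x.1 ^+ 2 +
    e * (x.1 * x.2) + f * x.2 ^+ 2) x =
  affine_fun (b * v.1 + c * v.2) (2 * d * v.1 + e * v.2)
    (e * v.1 + 2 * f * v.2) x.
Proof.
pose q := d * v.1 ^+ 2 + e * (v.1 * v.2) + f * v.2 ^+ 2.
set L := affine_fun _ _ _ x.
rewrite /derive; apply: cvg_lim => //.
apply: (@cvg_trans _ ((fun h : R => L + q * h) @ 0^')).
  apply: near_eq_cvg; near=> h.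
  have h0 : h != 0 by near: h; exact: nbhs_dnbhs_neq.
  rewrite /L /q /affine_fun /=.
  rewrite /GRing.scale /=.
  field.
  exact: h0.
have : (fun h : R => L + q * h) @ 0^' --> L + q * 0.
  apply: cvg_within_filter; apply: cvgD; first exact: cvg_cst.
  by apply: cvgM; [exact: cvg_cst|exact: cvg_id].
by rewrite mulr0 addr0.
Unshelve. all: by end_near. Qed.

Lemma bounded_mfun_affine_fun (D : domain R) a b c :
  bounded_mfun (D : set plane) (affine_fun a b c).
Proof.
split; first exact: measurable_funTS (measurable_affine_fun a b c).
have [B [_ DB]] := @dom_bounded _ D.
(* Boundedness gives a bound by every number strictly above [B]. *)
pose C := `|B| + 1.
have DC x : dom_set D x -> `|x.1| <= C /\ `|x.2| <= C.
  move=> Dx; have : `|x| <= C by apply: DB => //; rewrite ltr_pwDr// ler_norm.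
  by rewrite prod_normE ge_max => /andP[].
exists (`|a| + `|b| * C + `|c| * C) => x /DC[x1 x2].
rewrite /affine_fun (le_trans (ler_normD _ _))// lerD//.
  by rewrite (le_trans (ler_normD _ _))// lerD// normrM ler_wpM2l.
by rewrite normrM ler_wpM2l.
Qed.

Lemma lebesgue2_domain_lty (D : domain R) : (lebesgue2 R D < +oo)%E.
Proof.
have [B [_ DB]] := @dom_bounded _ D.
pose C := `|B| + 1.
(* The norm of the plane is the maximum norm, so [D] lies in this square. *)
apply: (@le_lt_trans _ _ (lebesgue2 R (`[- C, C] `*` `[- C, C]))).
  apply: le_measure; rewrite ?inE.
  - exact: open_measurable2 (@dom_open _ D).
  - by apply: measurableX.
  move=> x Dx; have : `|x| <= C by apply: DB => //; rewrite ltr_pwDr// ler_norm.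
  by rewrite prod_normE ge_max => /andP[]; rewrite !ler_norml /= !in_itv.
rewrite lebesgue2X//.
by rewrite lebesgue_measure_itv/=; case: ifP => _; rewrite ?mule0 ?ltry.
Qed.

(* [E] is the part of [D] in the open triangles; the rest of [D] lies on the
   finitely many lines that carry the edges. *)
Lemma P2_space_derive_bounded (D : domain R) (Th : triangulation D) :
  exists E : set plane, [/\ measurable E, E `<=` D,
    (lebesgue2 R).-negligible (D `\` E) &
    forall f, P2_space Th f -> forall a v,
      bounded_mfun E (fun x => 'D_v (fun z : R * R => f z 0 a) x)].
Proof.
have /choice[A lP] (t : 'I_(tri_num Th)) :
    exists abc : ('I_3 -> R) * ('I_3 -> R) * ('I_3 -> R),
    [/\ forall i, (abc.1.2 i != 0) || (abc.2 i != 0),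
        forall w x, \sum_i w i = 1 -> x = \sum_i w i *: tri t i ->
          forall i, affine_fun (abc.1.1 i) (abc.1.2 i) (abc.2 i) x = w i
      & forall x, \sum_i affine_fun (abc.1.1 i) (abc.1.2 i) (abc.2 i) x = 1 /\
          x = \sum_i affine_fun (abc.1.1 i) (abc.1.2 i) (abc.2 i) x *: tri t i].
  by have [a [b [c ?]]] := barycentric_coords (@tri_nondegenerate _ _ Th t);
    exists (a, b, c).
pose l t i x := affine_fun ((A t).1.1 i) ((A t).1.2 i) ((A t).2 i) x.
(* The open triangle: all barycentric coordinates are positive. *)
pose core t := [set x : R * R | forall i, 0 < l t i x].
have core_open t : open (core t).
  rewrite openE => x cx.
  suff : \forall z \near x, forall i, 0 < l t i z by [].
  apply: (@filter_forall _ _ _ (nbhs x) (nbhs_filter x)) => i.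
  apply: (cvgr_gt _ (@continuous_affine_fun ((A t).1.1 i) ((A t).1.2 i)
    ((A t).2 i) x)).
  exact: cx.
have core_tri t x : core t x -> triangle (tri t) x.
  have [_ _ /(_ x)[l1 lx]] := lP t.
  move=> cx; exists (fun i => l t i x); split => // [i|i].
    exact/ltW/cx.
  by rewrite inE.
have mD := open_measurable2 (@dom_open _ D).
have mcore t : measurable (D `&` core t : set plane).
  by apply: measurableI => //; exact: open_measurable2.
exists (\bigcup_(t in [set: 'I_(tri_num Th)]) (D `&` core t)); split.
- exact: fin_bigcup_measurable.
- by move=> x [t _ []].
(* A point of [D] lies in some closed triangle, with nonnegative coordinates there; if none of them
   vanishes, it is in the core. Each coordinate vanishes only on a line. *)
- suff : \forall x \ae lebesgue2 R, forall t i, l t i x != 0.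
    apply: negligibleS => x [Dx /= nx]; apply: contra_not nx => lx.
    have : closure D x by exact: subset_closure.
    rewrite (@tri_cover _ _ Th) => -[t _ [w [w0 w1 _ xw]]].
    exists t => //; split => // i /=.
    have [_ /(_ w x w1 xw i) lw _] := lP t.
    by rewrite lt_def lx [l t i x]lw w0.
  apply: filter_forall => t; apply: filter_forall => i.
  have [/(_ i) bc _ _] := lP t.
  by apply: negligibleS (lebesgue2_line ((A t).1.1 i) bc) => x /= /negP;
    rewrite negbK => /eqP.
(* Around a point of the open triangle [f] agrees with a quadratic, so its derivative there is an
   affine function, bounded on [D]. *)
- move=> f [_ fq _] a v; apply: bounded_mfun_bigcup => // t.
  have [qa [qb [qc [qd [qe [qf fE]]]]]] := fq t a.
  apply: (@eq_bounded_mfun _ _ _ _ (affine_fun (qb * v.1 + qc * v.2)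
      (2 * qd * v.1 + qe * v.2) (qe * v.1 + 2 * qf * v.2))).
    move=> x /set_mem[Dx cx].
    rewrite -(derive_quadratic qa); apply: near_eq_derive.
    have : nbhs x (core t) by exact: open_nbhs_nbhs.
    by apply: filterS => z /core_tri/fE.
  by apply: bounded_mfunS (bounded_mfun_affine_fun D _ _ _) => // x [].
Qed.

End Triangulation.

(** * Almost everywhere bounds on the viscosity data *)

Section Coefficients.
Variables (R : realType) (D : domain R).

Lemma Linfty_ae_bound f : f \in Lfun (lebesgue_on D) +oo%E ->
  \forall x \ae lebesgue_on D,
    `|f x| <= fine ('N[lebesgue_on D]_+oo[EFin \o f])%E.
Proof.
move=> /sub_Lfun_finLfun; rewrite inE /= /finite_norm => foo.
have fineN : ('N[lebesgue_on D]_+oo[EFin \o f])%E \is a fin_num.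
  by rewrite ge0_fin_numE// Lnorm_ge0.
(* The norm unfolds to an essential supremum only for a nonzero measure; for the zero measure every
   property holds almost everywhere. *)
have [mu0|] := boolP (0 < lebesgue_on D [set: _])%E; last first.
  rewrite -leNgt measure_le0 => /eqP mu0.
  by exists setT; split => //; exact: measurableT.
have : \forall x \ae lebesgue_on D,
    (abse ((EFin \o f) x) <= 'N[lebesgue_on D]_+oo[EFin \o f])%E.
  by rewrite unlock mu0; exact: ess_sup_ge.
by apply: filterS => x; rewrite -lee_fin fineK.
Qed.

(** Positivity excludes the value -oo, which [fine] would turn into 0; the value +oo cannot lie
    below a real [f x]. *)
Lemma ess_inf_ae_le (f : R * R -> R) :
  (0 < ess_inf (lebesgue_on D) (EFin \o f))%E ->
  \forall x \ae lebesgue_on D, fine (ess_inf (lebesgue_on D) (EFin \o f)) <= f x.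
Proof.
move=> f0; apply: filterS (ess_inf_le (lebesgue_on D) (EFin \o f)) => x.
by case: ess_inf f0.
Qed.

Lemma ess_sup_ae_ge (f : R * R -> R) :
  (ess_sup (lebesgue_on D) (EFin \o f) < +oo)%E ->
  \forall x \ae lebesgue_on D, f x <= fine (ess_sup (lebesgue_on D) (EFin \o f)).
Proof.
move=> f0; apply: filterS (ess_sup_ge (lebesgue_on D) (EFin \o f)) => x.
by case: ess_sup f0.
Qed.

(** Partial sums of a nonnegative series stay below its sum; finiteness of [chi] makes every term
    finite, so [fine] loses nothing. *)
Lemma sum_chi_term_le (lambda : nat -> R) (nu : nat -> R * R -> R) M :
  (chi D lambda nu < +oo)%E ->
  \sum_(m < M) fine (chi_term D lambda nu m.+1) <= fine (chi D lambda nu).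
Proof.
move=> chi_lty.
have t0 m : (0 <= chi_term D lambda nu m)%E by exact: Lnorm_ge0.
have chi_ge : (\sum_(m < M) chi_term D lambda nu m.+1 <= chi D lambda nu)%E.
  (* The series starts at 1, so its partial sum below [M.+1] has the indices 1 to [M]. *)
  apply: le_trans (nneseries_lim_ge M.+1 _) => //.
  by rewrite big_add1 /= big_mkord.
have chi_fin : chi D lambda nu \is a fin_num.
  by rewrite ge0_fin_numE// (le_trans _ chi_ge)// sume_ge0.
rewrite -lee_fin fineK// -sumEFin (le_trans _ chi_ge)//.
apply: lee_sum => m _; rewrite fineK// ge0_fin_numE//.
apply: le_lt_trans chi_lty; apply: le_trans chi_ge.
by rewrite (bigD1 m)//= leeDl// sume_ge0.
Qed.

(** [lebesgue_on D] measures a set by its trace on [D], so the trace of an exceptional set is null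
    for [lebesgue2]. *)
Lemma ae_lebesgue_on_negligible (P : R * R -> Prop) :
  (\forall x \ae lebesgue_on D, P x) ->
  (lebesgue2 R).-negligible (D `&` [set x | ~ P x]).
Proof.
move=> [A [mA A0 PA]]; exists (A `&` D); split.
- by apply: measurableI => //; exact: open_measurable2 (@dom_open _ D).
- exact: A0.
- by move=> x [Dx nPx]; split => //; exact: PA.
Qed.

(** Removes from the open triangles the null set where [P] may fail. What [D] loses is null, so
    integrals of arbitrary functions are preserved. *)
Lemma P2_space_good_set (Th : triangulation D) (P : R * R -> Prop) :
  (\forall x \ae lebesgue_on D, P x) ->
  exists E : set (measurableTypeR R * measurableTypeR R), [/\
    measurable E,
    (lebesgue2 R E < +oo)%E,
    forall f, \int[lebesgue2 R]_(x in D) f x = \int[lebesgue2 R]_(x in E) f x,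
    forall f, P2_space Th f -> forall a v,
      bounded_mfun E (fun x => 'D_v (fun z : R * R => f z 0 a) x) &
    forall x, E x -> P x].
Proof.
move=> /ae_lebesgue_on_negligible[B [mB B0 PB]].
have [E [mE ED [C [mC C0 EC]] dE]] := P2_space_derive_bounded Th.
have mD := open_measurable2 (@dom_open _ D).
have mEB : measurable (E `\` B) by exact: measurableD.
have EBD : E `\` B `<=` D by move=> x [/ED].
exists (E `\` B); split => //.
- apply: le_lt_trans (lebesgue2_domain_lty D).
  by apply: le_measure; rewrite ?inE.
- move=> f; rewrite /Rintegral (integral_null_setD _ EBD)//.
    exact: measurableD.
  apply: measure_negligible; first exact: measurableD.
  apply: (@negligibleS _ _ _ (lebesgue2 R) (C `|` B)); last first.
    have nC : (lebesgue2 R).-negligible C by apply/negligibleP.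
    have nB : (lebesgue2 R).-negligible B by apply/negligibleP.
    exact: negligibleU nC nB.
  move=> x [Dx nEB]; have [Ex|nEx] := pselect (E x); last by left; exact: EC.
  by right; apply: contrapT => nBx; apply: nEB.
- by move=> f /dE + a v => /(_ a v); apply: bounded_mfunS => // x [].
- move=> x [/ED Dx nBx]; apply: contrapT => nPx; apply: nBx; exact: PB.
Qed.

End Coefficients.

(** * Quadratic forms of Kronecker products *)

Section TensorForm.
Variable R : realType.

(** The finite element coefficient vector attached to the [i]-th stochastic basis function. *)
Definition tens_block n N (v : 'cV[R]_(n * N)) i : 'cV[R]_N :=
  \col_k v (mxtens_index (i, k)) 0.

Lemma mx_form n (A : 'M[R]_n) (u w : 'cV[R]_n) :
  (u^T *m A *m w) 0 0 = \sum_k \sum_l u k 0 * w l 0 * A k l.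
Proof.
rewrite mxE exchange_big; apply: eq_bigr => l _ /=.
rewrite mxE mulr_suml; apply: eq_bigr => k _.
by rewrite mxE; ring.
Qed.

Lemma tens_form n N (G : 'M[R]_n) (S : 'M[R]_N) (v : 'cV[R]_(n * N)) :
  (v^T *m (G *t S) *m v) 0 0 =
  \sum_i \sum_j G i j * ((tens_block v i)^T *m S *m tens_block v j) 0 0.
Proof.
have reindex_tens (F : 'I_(n * N) -> R) :
    \sum_i F i = \sum_i \sum_k F (mxtens_index (i, k)).
  rewrite pair_big /= (reindex (@mxtens_index n N)) /=.
    by apply: eq_bigr => -[].
  exists (@mxtens_unindex n N) => i _; first exact: mxtens_indexK.
  exact: mxtens_unindexK.
rewrite mx_form reindex_tens; apply: eq_bigr => i _.
under eq_bigr do rewrite reindex_tens.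
rewrite exchange_big; apply: eq_bigr => j _ /=.
rewrite mx_form mulr_sumr; apply: eq_bigr => k _.
rewrite mulr_sumr; apply: eq_bigr => l _.
by rewrite tensmxE !mxE; ring.
Qed.

Lemma tens_form1 n N (S : 'M[R]_N) (v : 'cV[R]_(n * N)) :
  (v^T *m (1%:M *t S) *m v) 0 0 =
  \sum_i ((tens_block v i)^T *m S *m tens_block v i) 0 0.
Proof.
rewrite tens_form; apply: eq_bigr => i _.
rewrite (bigD1 i)//= big1 ?addr0 => [|j ji]; first by rewrite mxE eqxx mul1r.
by rewrite mxE eq_sym (negbTE ji) mul0r.
Qed.

Lemma tens_block_neq0 n N (v : 'cV[R]_(n * N)) : v != 0 ->
  exists i, tens_block v i != 0.
Proof.
move=> v0; apply/existsP; apply: contraNT v0; rewrite negb_exists => /forallP b0.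
apply/eqP/colP => p; case: (mxtens_indexP p) => i k.
by have := b0 i; rewrite negbK => /eqP/colP/(_ k); rewrite !mxE.
Qed.

(** The forms of both products with the identity split into blocks, so the equivalence of [A] and
    [B] carries over blockwise; it is then chained with the comparison of [C] to the form of [A]. *)
Lemma rayleigh_tens1 n N (A B : 'M[R]_N) (C : 'M[R]_(n * N))
    (delta Delta lo hi : R) (v : 'cV[R]_(n * N)) :
  0 < delta -> 0 <= lo ->
  (forall w : 'cV[R]_N, 0 <= (w^T *m A *m w) 0 0) ->
  (forall w : 'cV[R]_N, w != 0 -> delta <= rayleigh A B w <= Delta) ->
  lo * (v^T *m (1%:M *t A) *m v) 0 0 <= (v^T *m C *m v) 0 0
    <= hi * (v^T *m (1%:M *t A) *m v) 0 0 ->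
  v != 0 ->
  lo * delta <= rayleigh C (1%:M *t B) v <= hi * Delta.
Proof.
move=> d0 lo0 A0 AB /andP[Clo Chi] v0.
have ABw (w : 'cV[R]_N) : [/\ 0 <= (w^T *m B *m w) 0 0,
    w != 0 -> 0 < (w^T *m B *m w) 0 0,
    delta * (w^T *m B *m w) 0 0 <= (w^T *m A *m w) 0 0 &
    (w^T *m A *m w) 0 0 <= Delta * (w^T *m B *m w) 0 0].
  have [->|w0] := eqVneq w 0; first by rewrite !mulmx0 !mxE !mulr0.
  have /andP[dAB ABD] := AB w w0.
  (* A positive quotient with nonnegative numerator has a positive denominator; a zero numerator
     would make the quotient zero. *)
  have B0 : 0 < (w^T *m B *m w) 0 0.
    have : 0 < rayleigh A B w by exact: lt_le_trans dAB.
    rewrite /rayleigh; have := A0 w; rewrite le_eqVlt => /predU1P[<-|Aw].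
      by rewrite mul0r ltxx.
    by rewrite pmulr_rgt0// invr_gt0.
  split => //; first exact: ltW.
  - by rewrite -ler_pdivlMr.
  - by rewrite -ler_pdivrMr.
set a := (v^T *m (1%:M *t A) *m v) 0 0 in Clo Chi *.
have [i vi0] := tens_block_neq0 v0.
have b0 : 0 < (v^T *m (1%:M *t B) *m v) 0 0.
  rewrite tens_form1 (bigD1 i)//= ltr_pwDl//.
    by have [_ + _ _] := ABw (tens_block v i); exact.
  by apply: sumr_ge0 => j _; have [] := ABw (tens_block v j).
have dba : delta * (v^T *m (1%:M *t B) *m v) 0 0 <= a.
  rewrite /a !tens_form1 mulr_sumr; apply: ler_sum => j _.
  by have [] := ABw (tens_block v j).
have aDb : a <= Delta * (v^T *m (1%:M *t B) *m v) 0 0.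
  rewrite /a !tens_form1 mulr_sumr; apply: ler_sum => j _.
  by have [] := ABw (tens_block v j).
have a0 : 0 < a by apply: lt_le_trans dba; exact: mulr_gt0.
(* Since lo a <= hi a with a > 0, [hi] is at least [lo]. *)
have hi0 : 0 <= hi.
  by rewrite (le_trans lo0)// -(ler_pM2r a0) (le_trans Clo).
rewrite /rayleigh ler_pdivlMr// ler_pdivrMr// -!mulrA.
rewrite (le_trans _ Clo) ?ler_wpM2l//=.
by rewrite (le_trans Chi)// ler_wpM2l.
Qed.

End TensorForm.

(** * Stiffness forms as integrals over the good set *)

Section StiffnessForm.
Variables (R : realType) (D : domain R) (N : nat).
Variable phi : 'I_N -> R * R -> 'rV[R]_2.
Variable E : set (measurableTypeR R * measurableTypeR R).
Hypothesis mE : measurable E.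
Hypothesis Eoo : (lebesgue2 R E < +oo)%E.
Hypothesis intDE : forall f,
  \int[lebesgue2 R]_(x in D) f x = \int[lebesgue2 R]_(x in E) f x.
Hypothesis bphi : forall k a v,
  bounded_mfun E (fun x => 'D_v (fun z : R * R => phi k z 0 a) x).

(** The index pairs a component with a direction, so that [grad_dot] is a single sum over the four
    Jacobian entries. *)
Definition grad_comp (c : 'I_2 * bool) (k : 'I_N) (x : R * R) : R :=
  'D_(if c.2 then (1, 0) else (0, 1)) (fun z => phi k z 0 c.1) x.

Lemma grad_dotE k l x :
  grad_dot (phi k) (phi l) x = \sum_c grad_comp c k x * grad_comp c l x.
Proof.
rewrite /grad_dot -(pair_big xpredT xpredT (fun a b =>
  grad_comp (a, b) k x * grad_comp (a, b) l x)) /=.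
by apply: eq_bigr => a _; rewrite big_bool.
Qed.

(** A Jacobian entry of the function with coefficients [w], taken as a combination of derivatives so
    that linearity in [w] holds by construction. *)
Definition grad_field (w : 'cV[R]_N) c x := \sum_k w k 0 * grad_comp c k x.

Lemma bounded_mfun_grad_comp c k : bounded_mfun E (grad_comp c k).
Proof. exact: bphi. Qed.

Lemma bounded_mfun_grad_field w c : bounded_mfun E (grad_field w c).
Proof.
apply: bounded_mfun_sum => k.
apply: bounded_mfunM; [exact: bounded_mfun_cst|exact: bounded_mfun_grad_comp].
Qed.

Lemma stiffness_form (a : R * R -> R) u w : bounded_mfun E a ->
  (u^T *m stiffness D phi a *m w) 0 0 =
  \int[lebesgue2 R]_(x in E) (a x * \sum_c grad_field u c x * grad_field w c x).
Proof.
move=> ba.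
have bgg c k l : bounded_mfun E (fun x => a x * (grad_comp c k x * grad_comp c l x)).
  by apply: bounded_mfunM => //; apply: bounded_mfunM;
    exact: bounded_mfun_grad_comp.
under eq_Rintegral do rewrite mulr_sumr.
rewrite Rintegral_sum//; last first.
  by move=> c; apply: bounded_mfunM => //; apply: bounded_mfunM;
    exact: bounded_mfun_grad_field.
rewrite (eq_bigr (fun c => \sum_k \sum_l u k 0 * w l 0 *
    \int[lebesgue2 R]_(x in E) (a x * (grad_comp c k x * grad_comp c l x))));
    last first.
  move=> c _; apply: Rintegral_form => // k; exact: bounded_mfun_grad_comp.
rewrite mx_form [RHS]exchange_big; apply: eq_bigr => k _ /=.
rewrite [RHS]exchange_big; apply: eq_bigr => l _ /=.
rewrite -mulr_sumr mxE intDE; congr (_ * _).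
rewrite -Rintegral_sum//; apply: eq_Rintegral => x _.
by rewrite grad_dotE mulr_sumr.
Qed.

(** The block sums are moved under the integral and inside the sum over [c], so that [G] acts at
    each point on the values of one Jacobian entry. *)
Lemma tens_stiffness_form n (G : 'M[R]_n) (a : R * R -> R) v :
  bounded_mfun E a ->
  (v^T *m (G *t stiffness D phi a) *m v) 0 0 =
  \int[lebesgue2 R]_(x in E) (a x * \sum_c \sum_i \sum_j
    G i j * (grad_field (tens_block v i) c x * grad_field (tens_block v j) c x)).
Proof.
move=> ba; rewrite tens_form.
have bUU i j : bounded_mfun E (fun x => a x * \sum_c
    grad_field (tens_block v i) c x * grad_field (tens_block v j) c x).
  apply: bounded_mfunM => //; apply: bounded_mfun_sum => c.
  by apply: bounded_mfunM; exact: bounded_mfun_grad_field.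
have bGUU i j : bounded_mfun E (fun x => G i j * (a x * \sum_c
    grad_field (tens_block v i) c x * grad_field (tens_block v j) c x)).
  by apply: bounded_mfunM => //; exact: bounded_mfun_cst.
transitivity (\int[lebesgue2 R]_(x in E) \sum_i \sum_j G i j * (a x * \sum_c
    grad_field (tens_block v i) c x * grad_field (tens_block v j) c x)).
  rewrite Rintegral_sum//; last by move=> i; exact: bounded_mfun_sum.
  apply: eq_bigr => i _; rewrite Rintegral_sum//; apply: eq_bigr => j _.
  by rewrite stiffness_form// RintegralZl//; exact: bounded_mfun_integrable.
apply: eq_Rintegral => x _; rewrite [in RHS]exchange_big mulr_sumr /=.
apply: eq_bigr => i _; rewrite [in RHS]exchange_big mulr_sumr /=.
by apply: eq_bigr => j _; rewrite mulrCA -mulr_sumr.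
Qed.

End StiffnessForm.

(** * Pointwise comparison of integrands and the spectral bounds *)

Theorem lemma7p1 (R : realType) (D : domain R)
    (nu0 : R * R -> R) (sigma : R) (lambda : nat -> R) (nu : nat -> R * R -> R)
    (delta Delta : R)
    (Th : triangulation D) (N : nat) (phi : 'I_N -> R * R -> 'rV[R]_2)
    (Amg : 'M[R]_N)
    (M k : nat) (psi : 'I_'C(M + k, k) -> M.-tuple R -> R)
    (nu0_Linfty : nu0 \in Lfun (lebesgue_on D) +oo%E)
    (nu0_inf_gt0 : (0 < ess_inf (lebesgue_on D) (EFin \o nu0))%E)
    (nu0_sup_lty : (ess_sup (lebesgue_on D) (EFin \o nu0) < +oo)%E)
    (sigma_gt0 : 0 < sigma)
    (lambda_ge0 : forall m, (1 <= m)%N -> 0 <= lambda m)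
    (nu_Linfty : forall m, (1 <= m)%N ->
      (fun x => Num.sqrt (lambda m) * nu m x) \in Lfun (lebesgue_on D) +oo%E)
    (chi_lty : (chi D lambda nu < +oo)%E)
    (nu0_dominates : Num.sqrt 3 * sigma * fine (chi D lambda nu)
      < fine (ess_inf (lebesgue_on D) (EFin \o nu0)))
    (phi_basis : P2_basis Th phi)
    (Amg_sym : Amg^T = Amg)
    (delta_gt0 : 0 < delta) (Delta_gt0 : 0 < Delta)
    (Amg_equiv : forall w : 'cV[R]_N, w != 0 ->
      delta <= rayleigh (stiffness D phi (cst 1)) Amg w <= Delta)
    (psi_legendre : legendre_basis k psi) :
  forall v : 'cV[R]_('C(M + k, k) * N), v != 0 ->
    (fine (ess_inf (lebesgue_on D) (EFin \o nu0))
       - Num.sqrt 3 * sigma * fine (chi D lambda nu)) * delta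
    <= rayleigh (sgfe_laplacian D phi nu0 sigma lambda nu psi) (1%:M *t Amg) v
    <= (fine (ess_sup (lebesgue_on D) (EFin \o nu0))
       + Num.sqrt 3 * sigma * fine (chi D lambda nu)) * Delta.
Proof.
move=> v v0.
set inf0 := fine (ess_inf _ _); set sup0 := fine (ess_sup _ _).
pose P x := (inf0 <= nu0 x <= sup0) /\
  forall m : 'I_M, `|Num.sqrt (lambda m.+1) * nu m.+1 x|
    <= fine (chi_term D lambda nu m.+1).
have aeP : \forall x \ae lebesgue_on D, P x.
  have FF := ae_filter_ringOfSetsType (lebesgue_on D).
  have ae0 : \forall x \ae lebesgue_on D, inf0 <= nu0 x <= sup0.
    apply: filterS2 (ess_inf_ae_le nu0_inf_gt0) (ess_sup_ae_ge nu0_sup_lty).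
    by move=> x -> ->.
  have aem : \forall x \ae lebesgue_on D, forall m : 'I_M,
      `|Num.sqrt (lambda m.+1) * nu m.+1 x|
        <= fine (chi_term D lambda nu m.+1).
    apply: (@filter_forall _ _ _ _
      (ae_filter_ringOfSetsType (lebesgue_on D))) => m.
    by apply: Linfty_ae_bound; exact: nu_Linfty.
  by apply: filterS2 ae0 aem => x.
have [E [mE Eoo intDE dE EP]] := P2_space_good_set Th aeP.
have bphi k' a w :
    bounded_mfun E (fun x => 'D_w (fun z : R * R => phi k' z 0 a) x).
  by apply: dE; have [+ _] := phi_basis; exact.
have mLfun f : f \in Lfun (lebesgue_on D) +oo%E -> measurable_fun E f.
  move=> /sub_Lfun_mfun; rewrite inE /= => mf.
  by apply: measurable_funTS.
have bnu0 : bounded_mfun E nu0.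
  split; first exact: mLfun.
  exists (`|inf0| + `|sup0|) => x /EP[/andP[lo hi] _].
  have := ler_norm (- inf0); rewrite normrN => inf0_ge.
  have := (ler_norm sup0, normr_ge0 inf0, normr_ge0 sup0) => -[[? ?] ?].
  by rewrite ler_norml; apply/andP; split; lra.
have KL_le m x : E x -> `|KL_term sigma lambda nu (m : 'I_M).+1 x|
    <= sigma * fine (chi_term D lambda nu m.+1).
  move=> /EP[_ /(_ m) num]; rewrite /KL_term -mulrA normrM (gtr0_norm sigma_gt0).
  by rewrite ler_pM2l.
have bKL (m : 'I_M) : bounded_mfun E (KL_term sigma lambda nu m.+1).
  split; last first.
    by exists (sigma * fine (chi_term D lambda nu m.+1)) => x; exact: KL_le.
  rewrite (_ : KL_term _ _ _ _ = fun x => sigma *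
      (Num.sqrt (lambda m.+1) * nu m.+1 x)); last first.
    by apply/funext => x; rewrite /KL_term mulrA.
  by apply: measurable_funM => //; apply: mLfun; exact: nu_Linfty.
pose U c i x := grad_field phi (tens_block v i) c x.
pose S x := \sum_c \sum_i U c i x ^+ 2.
have bU c i : bounded_mfun E (U c i) by exact: bounded_mfun_grad_field.
have bS : bounded_mfun E S.
  by apply: bounded_mfun_sum => c; apply: bounded_mfun_sum => i;
    under eq_fun do rewrite expr2; exact: bounded_mfunM.
pose F (G : 'M[R]_('C(M + k, k))) x :=
  \sum_c \sum_i \sum_j G i j * (U c i x * U c j x).
have bF G : bounded_mfun E (F G).
  apply: bounded_mfun_sum => c; apply: bounded_mfun_sum => i.
  apply: bounded_mfun_sum => j; apply: bounded_mfunM; last exact: bounded_mfunM.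
  exact: bounded_mfun_cst.
(* Hence the mean term and the form of the unweighted stiffness matrix are both covered by
   [tens_stiffness_form]. *)
have F1 x : F 1%:M x = S x.
  apply: eq_bigr => c _; apply: eq_bigr => i _.
  rewrite (bigD1 i)//= big1 ?addr0 => [|j ji]; first by rewrite mxE eqxx mul1r.
  by rewrite mxE eq_sym (negbTE ji) mul0r.
have S0 x : 0 <= S x.
  by apply: sumr_ge0 => c _; apply: sumr_ge0 => i _; exact: sqr_ge0.
pose Phi x := nu0 x * S x +
  \sum_(m < M) KL_term sigma lambda nu m.+1 x * F (galerkin psi m) x.
have bm (m : 'I_M) : bounded_mfun E
    (fun x => KL_term sigma lambda nu m.+1 x * F (galerkin psi m) x).
  exact: bounded_mfunM.
have bPhi : bounded_mfun E Phi.
  by apply: bounded_mfunD; [exact: bounded_mfunM|exact: bounded_mfun_sum].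
have PhiE : (v^T *m sgfe_laplacian D phi nu0 sigma lambda nu psi *m v) 0 0 =
    \int[lebesgue2 R]_(x in E) Phi x.
  rewrite /Phi RintegralD//; last 2 first.
  - by apply: bounded_mfun_integrable => //; exact: bounded_mfunM.
  - by apply: bounded_mfun_integrable => //; exact: bounded_mfun_sum.
  rewrite Rintegral_sum// /sgfe_laplacian mulmxDr mulmxDl mxE.
  rewrite (tens_stiffness_form mE Eoo intDE bphi)//; congr (_ + _).
    by apply: eq_Rintegral => x _; rewrite -F1.
  rewrite mulmx_sumr mulmx_suml summxE; apply: eq_bigr => m _.
  by rewrite (tens_stiffness_form mE Eoo intDE bphi).
have b1 : bounded_mfun E (cst 1 : R * R -> R) by exact: bounded_mfun_cst.
have SE : (v^T *m (1%:M *t stiffness D phi (cst 1)) *m v) 0 0 =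
    \int[lebesgue2 R]_(x in E) S x.
  rewrite (tens_stiffness_form mE Eoo intDE bphi)//.
  by apply: eq_Rintegral => x _; rewrite -F1 mul1r.
set chi0 := fine (chi D lambda nu).
have sum_le x : E x ->
    `|\sum_(m < M) KL_term sigma lambda nu m.+1 x * F (galerkin psi m) x|
      <= Num.sqrt 3 * sigma * chi0 * S x.
  move=> Ex; rewrite (le_trans (ler_norm_sum _ _ _))//.
  apply: (@le_trans _ _ (\sum_(m < M)
      sigma * fine (chi_term D lambda nu m.+1) * (Num.sqrt 3 * S x))).
    apply: ler_sum => m _; rewrite normrM ler_pM//; first exact: KL_le.
    rewrite (le_trans (ler_norm_sum _ _ _))// mulr_sumr; apply: ler_sum => c _.
    (* Applied at fixed [x] and [c], with the numbers [U c i x] as coefficients. *)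
    exact: galerkin_form_le psi_legendre.
  rewrite -mulr_suml -mulr_sumr.
  have -> : Num.sqrt 3 * sigma * chi0 * S x = sigma * chi0 * (Num.sqrt 3 * S x).
    by ring.
  rewrite ler_wpM2r ?mulr_ge0 ?sqrtr_ge0// ler_pM2l//.
  exact: sum_chi_term_le.
apply: (rayleigh_tens1 (A := stiffness D phi (cst 1))) => //.
(* The standing assumption on the data makes the lower constant nonnegative. *)
- by rewrite subr_ge0 ltW.
- move=> w; rewrite (stiffness_form mE Eoo intDE bphi)//.
  apply: Rintegral_ge0 => x _; rewrite mul1r; apply: sumr_ge0 => c _.
  by rewrite -expr2 sqr_ge0.
(* With the constants inside the integrals, it remains to compare [Phi] with multiples of [S]
   pointwise. *)
rewrite PhiE SE -!RintegralZl//; try exact: bounded_mfun_integrable.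
have bcS r : bounded_mfun E (fun x => r * S x).
  by apply: bounded_mfunM => //; exact: bounded_mfun_cst.
apply/andP; split; apply: le_Rintegral => //; try exact: bounded_mfun_integrable.
- move=> x Ex; have [/andP[lo _] _] := EP _ Ex.
  rewrite mulrBl /Phi lerD ?ler_wpM2r//.
  by have := sum_le _ Ex; rewrite ler_norml => /andP[].
- move=> x Ex; have [/andP[_ hi] _] := EP _ Ex.
  rewrite mulrDl /Phi lerD ?ler_wpM2r//.
  by have := sum_le _ Ex; rewrite ler_norml => /andP[].
Qed.
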